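(* Let $T>0$ and let $l,r:[0,T]\times\mathbb{R}\to\mathbb{R}$ satisfy Assumption (A) below. Then for every $s\in C[0,T]$ and every $a\in\mathbb{R}$ with $l(T,a)\le 0\le r(T,a)$, the backward Skorokhod problem $\mathbb{BSP}_l^r(s,a)$ admits a unique solution $(x,k)\in C[0,T]\times BV[0,T]$.
   Context: $C[0,T]$ denotes the real continuous functions on $[0,T]$; $BV[0,T]$ the functions in $C[0,T]$ starting from $0$ with bounded variation; $I[0,T]$ the nondecreasing functions in $C[0,T]$ starting from $0$. Assumption (A) on $l,r:[0,T]\times\mathbb{R}\to\mathbb{R}$: (i) for each $x\in\mathbb{R}$, $l(\cdot,x),r(\cdot,x)\in C[0,T]$; (ii) for each $t\in[0,T]$, $l(t,\cdot)$ and $r(t,\cdot)$ are strictly increasing; (iii) there are constants $0<c<C<\infty$ such that for all $t\in[0,T]$, $x,y\in\mathbb{R}$: $c|x-y|\le|l(t,x)-l(t,y)|\le C|x-y|$ and $c|x-y|\le|r(t,x)-r(t,y)|\le C|x-y|$; (iv) $\inf_{(t,x)\in[0,T]\times\mathbb{R}}(r(t,x)-l(t,x))>0$. Backward Skorokhod problem: given $s\in C[0,T]$, $a\in\mathbb{R}$ with $l(T,a)\le0\le r(T,a)$, a pair $(x,k)\in C[0,T]\times BV[0,T]$ is a solution of $\mathbb{BSP}_l^r(s,a)$ if (i) $x_t=a+s_T-s_t+k_T-k_t$ for all $t\in[0,T]$; (ii) $l(t,x_t)\le 0\le r(t,x_t)$ for all $t\in[0,T]$; (iii) $k=k^r-k^l$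 with $k^r,k^l\in I[0,T]$ satisfying $\int_0^T \mathbf 1_{\{l(s,x_s)<0\}}\,dk^l_s=0$ and $\int_0^T \mathbf 1_{\{r(s,x_s)>0\}}\,dk^r_s=0$. *)

(* Defs.v *)
(* R : realType. Functions on [0,T] are modelled as
   functions R -> R; only their values on [0,T] matter. *)
From HB Require Import structures.
From mathcomp Require Import all_boot all_order all_algebra.
From mathcomp Require Import all_classical all_reals all_analysis.
Set Implicit Arguments. Unset Strict Implicit. Unset Printing Implicit Defensive.
Import Order.TTheory GRing.Theory Num.Theory.
Import numFieldNormedType.Exports.
Local Open Scope classical_set_scope.
Local Open Scope ring_scope.

Definition C0T {R : realType} (T : R) (f : R -> R) : Prop :=
  {within `[0, T], continuous f}.

Definition BV0T {R : realType} (T : R) (k : R -> R) : Prop :=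
  C0T T k /\ k 0 = 0 /\ bounded_variation 0 T k.

Definition I0T {R : realType} (T : R) (k : R -> R) : Prop :=
  C0T T k /\ k 0 = 0 /\
  (forall s t, 0 <= s -> s <= t -> t <= T -> k s <= k t).

Definition extT {R : realType} (T : R) (k : R -> R) : R -> R :=
  fun t => k (Num.min (Num.max t 0) T).

(* ∫_0^T 1_A(s) dk_s = 0 for k ∈ I[0,T], the integral being the
   Lebesgue–Stieltjes integral w.r.t. the measure dk on [0,T]
   (the measure of A ∩ [0,T] under the Lebesgue–Stieltjes measure of the
   constant extension of k, which is a cumulative function). *)
Definition stieltjes_null {R : realType} (T : R) (k : R -> R) (A : set R) : Prop :=
  exists F : cumulative R R, (F : R -> R) = extT T k /\
    lebesgue_stieltjes_measure F (A `&` `[0, T]) = 0%E.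

Definition assumptionA {R : realType} (T : R) (l r : R -> R -> R) : Prop :=
  (forall x, C0T T (fun t => l t x) /\ C0T T (fun t => r t x)) /\
  (forall t, 0 <= t <= T -> forall x y, x < y -> l t x < l t y /\ r t x < r t y) /\
  (exists c C : R, 0 < c /\ c < C /\
     forall t, 0 <= t <= T -> forall x y,
       c * `|x - y| <= `|l t x - l t y| /\ `|l t x - l t y| <= C * `|x - y| /\
       c * `|x - y| <= `|r t x - r t y| /\ `|r t x - r t y| <= C * `|x - y|) /\
  (exists delta : R, 0 < delta /\
     forall t, 0 <= t <= T -> forall x, delta <= r t x - l t x).

Definition BSP_solution {R : realType} (T : R) (l r : R -> R -> R)
    (s : R -> R) (a : R) (x k : R -> R) : Prop :=
  C0T T x /\ BV0T T k /\
  (forall t, 0 <= t <= T -> x t = a + s T - s t + k T - k t) /\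
  (forall t, 0 <= t <= T -> l t (x t) <= 0 /\ 0 <= r t (x t)) /\
  (exists kr kl : R -> R, I0T T kr /\ I0T T kl /\
     (forall t, 0 <= t <= T -> k t = kr t - kl t) /\
     stieltjes_null T kl [set t | l t (x t) < 0] /\
     stieltjes_null T kr [set t | r t (x t) > 0]).

(* Main.v *)
Require Import Defs.
From HB Require Import structures.
From mathcomp Require Import all_boot all_order all_algebra.
From mathcomp Require Import all_classical all_reals all_analysis.
From mathcomp Require Import lra.
Import Order.TTheory GRing.Theory Num.Theory.
Import numFieldNormedType.Exports.
Local Open Scope classical_set_scope.
Local Open Scope ring_scope.

(** Since l(t,.) and r(t,.) are bi-Lipschitz, their zeros U(t) and L(t) are
    continuous in t, and r - l > 0 gives L < U: the problem is the two-sided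
    Skorokhod reflection, backward in time, in the moving interval [L(t), U(t)].
    The Stieltjes conditions say that k^l (resp. k^r) is constant on every interval
    where x < U (resp. x > L).

    Uniqueness: while one solution x lies above another solution x', x is off L and
    x' is off U, so x - x' is nondecreasing in t; hence it cannot return to the value
    0 it has at T.

    Existence: on an interval so short that L, U and s oscillate by less than a
    fraction of the gap U - L, only one barrier can be reached, and the one-sided
    reflection by a running supremum is a solution. Solutions on adjacent intervals
    can be glued, and a supremum argument covers [0, T]. *)

(** * Continuity, truncation and exit times *)

Section continuity.
Context {R : realType}.
Implicit Types (f g : R -> R) (p q t T : R).

Lemma continuousPdist f : continuous f <->
  forall t e, 0 < e -> exists2 d, 0 < d & forall u, `|u - t| < d -> `|f u - f t| < e.
Proof.
split=> [fc t e e0|H t].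
  have /cvgrPdist_lt/(_ _ e0)/nbhs_ballP[d /= d0 dP] := fc t.
  exists d => // u ut; rewrite distrC; apply: dP.
  by rewrite /ball/= distrC.
apply/cvgrPdist_lt => e /(H t)[d d0 dP].
apply/nbhs_ballP; exists d => //= u; rewrite /ball/= distrC => ut.
by rewrite distrC; exact: dP.
Qed.

Lemma C0TPdist T f : C0T T f <->
  forall t, 0 <= t <= T -> forall e, 0 < e -> exists2 d, 0 < d &
    forall u, 0 <= u <= T -> `|u - t| < d -> `|f u - f t| < e.
Proof.
rewrite /C0T subspace_continuousP; split=> [fc t tT e e0|H t /=].
  have /fc/cvgrPdist_lt/(_ _ e0) : `[0, T]%classic t by rewrite /= in_itv.
  move=> /nbhs_ballP[d /= d0 dP].
  exists d => // u uT ut; rewrite distrC; apply: dP; last by rewrite /= in_itv.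
  by rewrite /ball/= distrC.
rewrite in_itv/= => tT.
apply/cvgrPdist_lt => e /(H t tT)[d d0 dP].
apply/nbhs_ballP; exists d => //= u; rewrite /ball/= distrC => ut.
by rewrite in_itv /= => uT; rewrite distrC; exact: dP.
Qed.

Lemma continuous_C0T T f : continuous f -> C0T T f.
Proof. exact: continuous_subspaceT. Qed.

(** Chosen so that [extT T f t] is convertible to [f (clamp 0 T t)]. *)
Definition clamp p q t := Num.min (Num.max t p) q.

Variant clamp_spec p q t : R -> Prop :=
| ClampLow of t <= p : clamp_spec p q t p
| ClampIn of p <= t & t <= q : clamp_spec p q t t
| ClampHigh of q <= t : clamp_spec p q t q.

Lemma clampP p q t : p <= q -> clamp_spec p q t (clamp p q t).
Proof.
move=> pq; rewrite /clamp /Num.max; case: (ltP t p) => tp.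
  by rewrite (min_idPl pq); constructor; exact: ltW.
by rewrite /Num.min; case: (ltP t q) => tq; constructor => //; exact: ltW.
Qed.

Lemma clamp_itv p q t : p <= q -> p <= clamp p q t <= q.
Proof. by move=> pq; case: clampP => //; lra. Qed.

Lemma clamp_id p q t : p <= t <= q -> clamp p q t = t.
Proof. by move=> tpq; case: clampP; lra. Qed.

Lemma clamp_le p q t u : p <= q -> t <= u -> clamp p q t <= clamp p q u.
Proof. by move=> pq tu; case: (clampP _ _ t) => //; case: clampP => //; lra. Qed.

Lemma clamp_dist p q t u : p <= q -> `|clamp p q t - clamp p q u| <= `|t - u|.
Proof.
move=> pq; have := ler_norm (t - u); have := ler_norm (u - t).
rewrite [`|u - t|]distrC ler_norml.
by case: (clampP _ _ t) => //; case: clampP => //; lra.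
Qed.

Lemma continuous_extT T f : 0 <= T -> C0T T f -> continuous (extT T f).
Proof.
move=> T0 /C0TPdist fc; apply/continuousPdist => t e e0.
have [d d0 dP] := fc (clamp 0 T t) (clamp_itv _ _ t T0) _ e0.
exists d => // u ut; apply: dP; first exact: clamp_itv.
by apply: le_lt_trans ut; exact: clamp_dist.
Qed.

Lemma extT_id T f t : 0 <= t <= T -> extT T f t = f t.
Proof. by move=> tT; rewrite -[in RHS](clamp_id _ _ _ tT). Qed.

Lemma first_exit f a b : continuous f -> a <= b -> 0 < f a -> f b <= 0 ->
  exists c, [/\ a <= c, c <= b, f c <= 0 & forall t, a <= t -> t < c -> 0 < f t].
Proof.
move=> /continuousPdist fc ab fa fb.
pose S := [set t | a <= t /\ f t <= 0].
have Sb : S b by [].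
have lS : has_lbound S by exists a => t [].
have iS : has_inf S by split; [exists b|].
have ac : a <= inf S by apply: lb_le_inf; [exists b|move=> t []].
exists (inf S); split => //.
- exact: ge_inf.
- rewrite leNgt; apply/negP => fi.
  have [d d0 dP] := fc (inf S) _ fi.
  have [t [at_ ft] tS] := inf_adherent d0 iS.
  have iSt : inf S <= t by apply: ge_inf.
  have : `|t - inf S| < d by rewrite ltr_norml; lra.
  by move=> /dP; rewrite ltr_norml; lra.
- move=> t at_ ti; rewrite ltNge; apply/negP => ft.
  by move: ti; rewrite ltNge ge_inf.
Qed.

End continuity.

(** * Null Stieltjes integrals as constancy on intervals *)

Section stieltjes_null.
Context {R : realType}.
Implicit Types (T p q : R) (k : R -> R) (A : set R).

Lemma lebesgue_stieltjes_itv (F : cumulative R R) p q : p <= q ->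
  lebesgue_stieltjes_measure F `]p, q]%classic = (F q - F p)%:E.
Proof.
move=> pq; rewrite /lebesgue_stieltjes_measure /measure_extension.
rewrite measurable_mu_extE; last exact: is_ocitv.
by rewrite /= wlength_itv_bnd.
Qed.

(** The half-open interval from [p] to [q] lies in [A] and in [0, T], and its measure is the
    increment of [k]; monotonicity of the outer measure makes that increment zero. *)
Lemma stieltjes_null_flat T k A p q : stieltjes_null T k A ->
  0 <= p -> p <= q -> q <= T -> (forall t, p <= t <= q -> A t) -> k p = k q.
Proof.
move=> [F [FE FA]] p0 pq qT pqA.
have : (lebesgue_stieltjes_measure F `]p, q]%classic <=
    lebesgue_stieltjes_measure F (A `&` `[0%R, T]))%E.
  apply: le_mu_ext => t /=; rewrite in_itv/= => /andP[pt tq].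
  by split; [apply: pqA|rewrite /= in_itv/=]; lra.
rewrite FA lebesgue_stieltjes_itv// lee_fin FE !extT_id; try lra.
move=> kqp; apply/eqP; rewrite eq_le; apply/andP; split; last by lra.
have : extT T k p <= extT T k q by rewrite -FE; exact: cumulative_is_nondecreasing.
by rewrite !extT_id; lra.
Qed.

(** A converse for relatively open [A]: countably many half-open intervals with rational ends cover
    it, each of measure zero because the extension of [k] has equal values at both ends. *)
Lemma flat_stieltjes_null T k A : 0 <= T -> I0T T k ->
  (forall t, 0 <= t <= T -> A t ->
    exists2 d, 0 < d & forall u, 0 <= u <= T -> `|u - t| < d -> A u) ->
  (forall p q, 0 <= p -> p <= q -> q <= T ->
    (forall t, p <= t <= q -> A t) -> k p = k q) ->
  stieltjes_null T k A.
Proof.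
move=> T0 [kc [k0 knd]] Aopen flat.
have kE t : extT T k t = k (clamp 0 T t) by [].
have end_ : nondecreasing (extT T k).
  move=> t u tu; rewrite !kE.
  have := clamp_itv _ _ t T0; have := clamp_itv _ _ u T0.
  by move=> /andP[? ?] /andP[? ?]; apply: knd => //; exact: clamp_le.
have erc : right_continuous (extT T k).
  by apply: right_continuousW; exact: continuous_extT.
have [F FE] : exists F : cumulative R R, (F : R -> R) = extT T k.
  pose I := isCumulative.Build R _ R (extT T k) end_ erc.
  by exists (HB.pack_for (cumulative R R) (extT T k) I).
exists F; split=> //.
apply/eqP; rewrite eq_le measure_ge0 andbT.
(* [B] enumerates the pairs of rationals; codes of no pair and unsuitable pairs contribute the empty
   set. *)
pose B (n : nat) : set R := if pickle_inv n is Some pq then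
  let p : R := ratr (pq : rat * rat).1 in let q : R := ratr pq.2 in
  if `[< p <= q /\ extT T k p = extT T k q >] then `]p, q]%classic else set0 else set0.
have B0 n : lebesgue_stieltjes_measure F (B n) = 0%E.
  rewrite /B; case: pickle_inv => [[p q]|]/=; last by rewrite measure0.
  case: asboolP => [[pq Fpq]|_]; last by rewrite measure0.
  by rewrite lebesgue_stieltjes_itv// FE Fpq subrr.
have AB : A `&` `[0, T] `<=` \bigcup_n B n.
  move=> t [At /=]; rewrite in_itv/= => tT.
  have [d d0 dP] := Aopen t tT At.
  have [p] : exists p : rat, ratr p \in `]t - d, t[ by apply: rat_in_itvoo; lra.
  have [q] : exists q : rat, ratr q \in `]t, t + d[ by apply: rat_in_itvoo; lra.
  rewrite !in_itv/= => tq pt.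
  exists (pickle (p, q)); first exact: Logic.I.
  rewrite /B pickleK_inv.
  rewrite asboolT/= ?in_itv/=; first by lra.
  split; first lra.
  (* The rational endpoints may fall outside [0, T]; clamping keeps them on either side of [t] and
     within [d] of it. *)
  have cp := clamp_itv _ _ (ratr p) T0; have cq := clamp_itv _ _ (ratr q) T0.
  have cpt : clamp 0 T (ratr p) <= t by rewrite -(clamp_id _ _ _ tT); apply: clamp_le => //; lra.
  have ctq : t <= clamp 0 T (ratr q) by rewrite -{1}(clamp_id _ _ _ tT); apply: clamp_le => //; lra.
  have near_t v : `|v - t| < d -> `|clamp 0 T v - t| < d.
    by move=> vt; rewrite -{1}(clamp_id _ _ _ tT); apply: le_lt_trans vt; exact: clamp_dist.
  have /near_t : `|ratr p - t| < d by rewrite ltr_norml; lra.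
  have /near_t : `|ratr q - t| < d by rewrite ltr_norml; lra.
  rewrite !ltr_norml => dq dp; rewrite !kE; apply: flat; try lra.
  by move=> u u1; apply: dP; rewrite ?ltr_norml; lra.
have le1 : (lebesgue_stieltjes_measure F (A `&` `[0%R, T]) <=
    lebesgue_stieltjes_measure F (\bigcup_n B n))%E by exact: le_mu_ext.
have le2 : (lebesgue_stieltjes_measure F (\bigcup_n B n) <=
    \sum_(n <oo) lebesgue_stieltjes_measure F (B n))%E.
  exact: mu_ext_sigma_subadditive.
apply: le_trans le1 (le_trans le2 _).
by rewrite eseries0// => n _ _; exact: B0.
Qed.

End stieltjes_null.

(** * Continuity in time of the zeros of [l] and [r] *)

Section zero_curve.
Context {R : realType}.

(** Zeros exist by the intermediate value theorem. For continuity, the lower Lipschitz bound gives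
    [c * |z u - z t| <= |f u (z t)|], which tends to 0 as [u] tends to [t]. *)
Lemma zero_curve (T c C : R) (f : R -> R -> R) : 0 <= T -> 0 < c ->
  (forall x, C0T T (f^~ x)) ->
  (forall t, 0 <= t <= T -> forall x y, x < y -> f t x < f t y) ->
  (forall t, 0 <= t <= T -> forall x y,
     c * `|x - y| <= `|f t x - f t y| /\ `|f t x - f t y| <= C * `|x - y|) ->
  exists z, continuous z /\ forall t, 0 <= t <= T -> f t (z t) = 0.
Proof.
move=> T0 c0 fc finc flip.
have z_ex t : exists x, 0 <= t <= T -> f t x = 0.
  have [tT|] := boolP (0 <= t <= T); last by exists 0.
  have ftc : continuous (f t).
    apply/continuousPdist => x e e0.
    have C0 : 0 < `|C| + 1 by apply: ltr_pwDr => //; exact: normr_ge0.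
    exists (e / (`|C| + 1)); first exact: divr_gt0.
    move=> y; rewrite ltr_pdivlMr// => yx.
    apply: le_lt_trans yx; apply: le_trans (proj2 (flip t tT y x)) _.
    rewrite mulrC ler_wpM2l//.
    by apply: le_trans (ler_norm C) _; lra.
  (* With slope at least [c], [f t] moves by at least [|f t 0|] over a distance [M], so a zero lies
     between [- M] and [M]. *)
  pose M := `|f t 0| / c.
  have M0 : 0 <= M by rewrite divr_ge0// ltW.
  have cM : c * M = `|f t 0| by rewrite mulrC divfK// gt_eqF.
  have grow x y : y <= x -> c * (x - y) <= f t x - f t y.
    rewrite le_eqVlt => /predU1P[->|yx]; first by rewrite !subrr mulr0.
    have [h _] := flip t tT x y; have fyx := finc t tT _ _ yx.
    by move: h; rewrite !gtr0_norm ?subr_gt0.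
  have fM : 0 <= f t M.
    have := grow M 0 M0; rewrite subr0 cM.
    by have := ler_norm (- f t 0); rewrite normrN; lra.
  have fN : f t (- M) <= 0.
    have := grow 0 (- M) ltac:(lra); rewrite sub0r opprK cM.
    by have := ler_norm (f t 0); lra.
  have [|||x _ fx] := @IVT R (f t) (- M) M 0; last by exists x.
  - lra.
  - exact: continuous_subspaceT.
  - by rewrite ge_min le_max fN fM orbT.
have [z0 z0P] := choice z_ex.
exists (extT T z0); split; last by move=> t tT; rewrite extT_id//; exact: z0P.
apply: continuous_extT => //; apply/C0TPdist => t tT e e0.
have /C0TPdist/(_ t tT _ (mulr_gt0 c0 e0))[d d0 dP] := fc (z0 t).
exists d => // u uT ut; have := dP u uT ut.
rewrite (z0P t tT) -(z0P u uT) distrC => h.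
have [h' _] := flip u uT (z0 u) (z0 t).
by rewrite -(ltr_pM2l c0); apply: le_lt_trans h' h.
Qed.

End zero_curve.

(** * Comparison of two solutions *)

Section uniqueness.
Context {R : realType}.

(* On an excursion of [x] above [x'] the path [x] avoids the lower barrier and
   [x'] the upper one, so [x - x'] cannot decrease, and never returns to 0. *)
Lemma BSP_solution_le (T : R) (l r : R -> R -> R) (s : R -> R) (a : R)
    (x k x' k' : R -> R) : 0 <= T ->
  (forall t, 0 <= t <= T -> {homo l t : y z / y < z}) ->
  (forall t, 0 <= t <= T -> {homo r t : y z / y < z}) ->
  BSP_solution T l r s a x k -> BSP_solution T l r s a x' k' ->
  forall t, 0 <= t <= T -> x t <= x' t.
Proof.
move=> T0 linc rinc.
move=> [xc [_ [xE [xlr [kr [kl [[_ [_ krm]] [[_ [_ klm]] [kE [_ knr]]]]]]]]]].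
move=> [xc' [_ [xE' [xlr' [kr' [kl' [[_ [_ krm']] [[_ [_ klm']] [kE' [knl' _]]]]]]]]]].
move=> t tT; rewrite leNgt; apply/negP => xt.
have fc : continuous (extT T x \- extT T x').
  by move=> u; apply: continuousB; exact: continuous_extT.
have fE u : 0 <= u <= T -> (extT T x \- extT T x') u = x u - x' u.
  by move=> uT; rewrite /= !extT_id.
have TT : 0 <= T <= T by rewrite T0 lexx.
have [||//|c [tc cT fc0 fpos]] := first_exit _ t T fc.
- by lra.
- by rewrite fE//; lra.
- by rewrite fE// xE// xE'//; lra.
have grow u : t <= u -> u < c -> x t - x' t <= x u - x' u.
  move=> tu uc; have uT : 0 <= u <= T by lra.
  have above v : t <= v <= u -> x' v < x v.
    move=> tvu; have vT : 0 <= v <= T by lra.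
    by have := fpos v ltac:(lra) ltac:(lra); rewrite fE//; lra.
  have kru : kr t = kr u.
    apply: (stieltjes_null_flat _ _ _ _ _ knr); try lra.
    move=> v tvu /=; have vT : 0 <= v <= T by lra.
    by have := rinc v vT _ _ (above v tvu); have := xlr' v vT; lra.
  have klu' : kl' t = kl' u.
    apply: (stieltjes_null_flat _ _ _ _ _ knl'); try lra.
    move=> v tvu /=; have vT : 0 <= v <= T by lra.
    by have := linc v vT _ _ (above v tvu); have := xlr v vT; lra.
  have klu := klm t u ltac:(lra) tu ltac:(lra).
  have kru' := krm' t u ltac:(lra) tu ltac:(lra).
  by rewrite !xE// !xE'// !kE// !kE'//; lra.
have cc : 0 <= c <= T by lra.
move: fc0; rewrite fE// => fc0.
have tltc : t < c.
  rewrite lt_neqAle tc andbT; apply/eqP => tE.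
  by move: fc0; rewrite -tE; lra.
have xt0 : 0 < x t - x' t by lra.
have /continuousPdist/(_ c _ xt0)[d d0 dP] := fc.
have [u [tu uc ud]] : exists u, [/\ t <= u, u < c & c - d < u].
  have [h|h] := leP t (c - d / 2); first by exists (c - d / 2); split; lra.
  by exists t; split; lra.
have : `|u - c| < d by rewrite ltr_norml; lra.
move/dP; rewrite !fE//; last by lra.
by have := grow u tu uc; rewrite ltr_norml; lra.
Qed.

End uniqueness.

(** * The backward running supremum *)

Section running_supremum.
Context {R : realType}.

(** [m t] is the supremum over [u >= t] of the positive part of [f], frozen outside [p, q]. It
    vanishes from [q] on since [f q <= 0], and it falls only where [f] touches it. *)
Lemma running_supremum (f : R -> R) (p q : R) : p <= q -> continuous f -> f q <= 0 ->
  exists m : R -> R, [/\ continuous m, {homo m : t u /~ t <= u},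
    (forall t, q <= t -> m t = 0), (forall t, t <= p -> m t = m p) &
    [/\ (forall t, p <= t <= q -> f t <= m t),
        (forall v, 0 <= v -> (forall u, p <= u <= q -> f u <= v) ->
           forall t, m t <= v) &
        (forall p' q', p <= p' -> p' <= q' -> q' <= q ->
           (forall t, p' <= t <= q' -> f t < m t) -> m p' = m q')]].
Proof.
move=> pq fc fq.
pose h t := Num.max 0 (f (clamp p q t)).
have h0 t : 0 <= h t by rewrite /h le_max lexx.
have fh t : p <= t <= q -> f t <= h t.
  by move=> tpq; rewrite /h clamp_id// le_max lexx orbT.
have hq t : q <= t -> h t = 0.
  move=> qt; have -> : h t = h q.
    by rewrite /h; congr (Num.max 0 (f _)); do 2?case: clampP => //; lra.
  by rewrite /h clamp_id ?lexx ?pq//; exact/max_idPl.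
have hp t : t <= p -> h t = h p.
  by move=> tp; rewrite /h; congr (Num.max 0 (f _)); do 2?case: clampP => //; lra.
have hfE t : p <= t <= q -> 0 < h t -> h t = f t.
  by move=> tpq; rewrite /h clamp_id// /Num.max; case: (ltP 0 (f t)) => //; rewrite ltxx.
have hc : forall t e, 0 < e ->
    exists2 d, 0 < d & forall u, `|u - t| < d -> `|h u - h t| < e.
  move=> t e e0; have /continuousPdist/(_ (clamp p q t) e e0)[d d0 dP] := fc.
  exists d => // u ut.
  have /dP : `|clamp p q u - clamp p q t| < d.
    by apply: le_lt_trans ut; exact: clamp_dist.
  rewrite /h; set a := f _; set b := f _; rewrite !ltr_norml /Num.max.
  by case: (ltP 0 a) => ?; case: (ltP 0 b) => ?; lra.
have hub v : 0 <= v -> (forall u, p <= u <= q -> f u <= v) -> forall t, h t <= v.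
  by move=> v0 fv t; rewrite /h ge_max v0 fv// clamp_itv.
have hC : continuous h by apply/continuousPdist.
have [M Mub] : exists M, forall t, h t <= M.
  have [c cpq cmax] := EVT_max pq (continuous_subspaceT hC).
  exists (h c) => t.
  have [tp|pt] := leP t p; first by rewrite hp// cmax// in_itv/= lexx.
  have [qt|tq] := leP q t; first by rewrite hq// h0.
  by rewrite cmax// in_itv/=; lra.
pose S t := [set y | exists2 u, t <= u & y = h u].
have Sub t : has_ubound (S t) by exists M => _ [u _ ->].
have Sne t : S t !=set0 by exists (h t), t.
pose m t := sup (S t).
have hm t u : t <= u -> h u <= m t by move=> tu; apply: ub_le_sup => //; exists u.
have mle t v : (forall u, t <= u -> h u <= v) -> m t <= v.
  by move=> H; apply: ge_sup => // _ [u tu ->]; exact: H.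
have mhomo : {homo m : t u /~ t <= u}.
  by move=> t u ut; apply: mle => v tv; apply: hm; exact: le_trans tv.
exists m; split=> //.
- apply/continuousPdist => t e e0.
  have [d d0 dP] := hc t (e / 3) ltac:(lra).
  exists d => // u ut.
  (* Passing from [t1] to [t2] discards only values of [h] between them; within [d] of [t] these
     exceed [h t2 <= m t2] by at most [2 * (e / 3)]. *)
  have step t1 t2 : t1 <= t2 -> `|t1 - t| < d -> `|t2 - t| < d ->
      m t1 <= m t2 + 2 * (e / 3).
    move=> t12 t1d t2d; apply: mle => v t1v.
    have [t2v|vt2] := leP t2 v; first by have := hm _ _ t2v; lra.
    have := hm t2 t2 (lexx _).
    have /dP : `|v - t| < d by move: t1d t2d; rewrite !ltr_norml; lra.
    have := dP _ t2d.
    by rewrite !ltr_norml; lra.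
  have td : `|t - t| < d by rewrite subrr normr0.
  have [ut'|tu'] := leP u t.
    by have := step _ _ ut' ut td; have := mhomo _ _ ut'; rewrite ltr_norml; lra.
  have := step _ _ (ltW tu') td ut; have := mhomo _ _ (ltW tu').
  by rewrite ltr_norml; lra.
- move=> t qt; apply/eqP; rewrite eq_le; apply/andP; split.
    by apply: mle => u tu; rewrite hq//; exact: le_trans tu.
  by rewrite -(hq t qt); exact: hm.
- move=> t tp; apply/eqP; rewrite eq_le (mhomo _ _ tp) andbT.
  apply: mle => u tu; have [pu|up] := leP p u; first exact: hm.
  by rewrite (hp _ (ltW up)); exact: hm.
split=> //.
- by move=> t tpq; apply: le_trans (fh t tpq) _; exact: hm.
- by move=> v v0 fv t; apply: mle => u _; exact: hub.
- move=> p' q' pp pq' qq fm; apply/eqP; rewrite eq_le (mhomo _ _ pq') andbT.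
  rewrite leNgt; apply/negP => mqp.
  (* If [m] dropped, the maximum [h c] over [p', q'] would be at least [m p'] and so positive,
     whence [f c = h c >= m p' >= m c], against [f c < m c]. *)
  have [c] := EVT_max pq' (continuous_subspaceT hC).
  rewrite in_itv/= => cpq cmax.
  have m0 : 0 <= m q' by apply: le_trans (h0 q') _; exact: hm.
  have mc : m p' <= Num.max (m q') (h c).
    apply: mle => u pu; rewrite le_max; have [qu|uq] := leP q' u.
      by rewrite hm.
    by rewrite cmax ?orbT// in_itv/=; lra.
  have : m p' <= h c by move: mc; rewrite le_max => /orP[|//]; lra.
  move=> mpc; have hc0 : 0 < h c by lra.
  have := fm c cpq; rewrite -hfE//; last by lra.
  have : m c <= m p' by apply: mhomo; lra.
  by lra.
Qed.

End running_supremum.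

(** * Two-sided reflection between moving barriers *)

Section reflection.
Context {R : realType}.
Implicit Types (L U s k kr kl : R -> R) (p q b t : R).

(** The complementarity condition that [dk] does not charge [P], phrased without measures. *)
Definition flat_on (P : R -> Prop) k p q := forall p' q',
  p <= p' -> p' <= q' -> q' <= q -> (forall t, p' <= t <= q' -> P t) -> k p' = k q'.

Lemma flat_onU P k o p q : flat_on P k o p -> flat_on P k p q -> flat_on P k o q.
Proof.
move=> kop kpq p' q' op' pq' qq' H.
have [qp|pq1] := leP q' p; first exact: kop.
have [pp|pp] := leP p p'; first exact: kpq.
rewrite (kop p' p) ?(kpq p q')//; try lra.
  by move=> t tp; apply: H; lra.
by move=> t tp; apply: H; lra.
Qed.

Definition reflected_path s q b kr kl t :=
  b + s q - s t + (kr q - kr t) - (kl q - kl t).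

(* The regulators [kr], [kl] are constant outside [p, q], so that regulators of
   adjacent intervals can simply be added. *)
Record reflects L U s p q b kr kl : Prop := Reflects {
  reflects_contr : continuous kr;
  reflects_contl : continuous kl;
  reflects_homor : {homo kr : t u / t <= u};
  reflects_homol : {homo kl : t u / t <= u};
  reflects_before : forall t, t <= p -> kr t = kr p /\ kl t = kl p;
  reflects_after : forall t, q <= t -> kr t = kr q /\ kl t = kl q;
  reflects_itv : forall t, p <= t <= q ->
    L t <= reflected_path s q b kr kl t <= U t;
  reflects_flatr : flat_on (fun t => L t < reflected_path s q b kr kl t) kr p q;
  reflects_flatl : flat_on (fun t => reflected_path s q b kr kl t < U t) kl p q }.

(** Negation exchanges the barriers and the two regulators, so reflection at the upper barrier
    follows from reflection at the lower one. *)
Lemma reflectsN L U s p q b kr kl :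
  reflects (\- U) (\- L) (\- s) p q (- b) kl kr -> reflects L U s p q b kr kl.
Proof.
move=> [c1 c2 h1 h2 bf af itv f1 f2].
have pathN t : reflected_path (\- s) q (- b) kl kr t = - reflected_path s q b kr kl t.
  by rewrite /reflected_path/=; lra.
split=> //.
- by move=> t /bf[].
- by move=> t /af[].
- by move=> t /itv; rewrite pathN/=; lra.
- move=> p' q' ? ? ? H; apply: f2 => // t /H; rewrite pathN/=; lra.
- move=> p' q' ? ? ? H; apply: f1 => // t /H; rewrite pathN/=; lra.
Qed.

Definition solvable L U s p q := forall b, L q <= b <= U q ->
  exists kr kl, reflects L U s p q b kr kl.

(** Time runs backward: [p, q] is solved first, and the value reached at [p] is the terminal value
    on [o, p]. Each regulator is constant on the other interval, so sums keep the right
    increments. *)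
Lemma solvable_trans L U s o p q : o <= p <= q ->
  solvable L U s o p -> solvable L U s p q -> solvable L U s o q.
Proof.
move=> /andP[op pq] S1 S2 b bq.
have [kr2 [kl2 H2]] := S2 b bq.
pose b1 := reflected_path s q b kr2 kl2 p.
have [kr1 [kl1 H1]] := S1 b1 (reflects_itv _ _ _ _ _ _ _ _ H2 p ltac:(lra)).
pose kr t := kr1 t + kr2 t; pose kl t := kl1 t + kl2 t.
have path1 t : t <= p ->
    reflected_path s q b kr kl t = reflected_path s p b1 kr1 kl1 t.
  move=> tp; have [e1 e2] := reflects_before _ _ _ _ _ _ _ _ H2 t tp.
  have [e3 e4] := reflects_after _ _ _ _ _ _ _ _ H1 q pq.
  by rewrite /b1 /reflected_path /kr /kl e1 e2 e3 e4; lra.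
have path2 t : p <= t ->
    reflected_path s q b kr kl t = reflected_path s q b kr2 kl2 t.
  move=> pt; have [e1 e2] := reflects_after _ _ _ _ _ _ _ _ H1 t pt.
  have [e3 e4] := reflects_after _ _ _ _ _ _ _ _ H1 q pq.
  by rewrite /reflected_path /kr /kl e1 e2 e3 e4; lra.
case: H1 => c1 c2 h1 h2 bf1 af1 itv1 f1 f2.
case: H2 => c3 c4 h3 h4 bf2 af2 itv2 f3 f4.
have flatr : flat_on (fun t => L t < reflected_path s q b kr kl t) kr o q.
  apply: (flat_onU _ _ _ p) => p1 q1 op1 pq1 qp H.
    rewrite /kr (f1 p1 q1)//; last by move=> t tpq; rewrite -path1 ?H//; lra.
    by rewrite (proj1 (bf2 p1 _)) ?(proj1 (bf2 q1 _))//; lra.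
  rewrite /kr (f3 p1 q1)//; last by move=> t tpq; rewrite -path2 ?H//; lra.
  by rewrite (proj1 (af1 p1 _)) ?(proj1 (af1 q1 _))//; lra.
have flatl : flat_on (fun t => reflected_path s q b kr kl t < U t) kl o q.
  apply: (flat_onU _ _ _ p) => p1 q1 op1 pq1 qp H.
    rewrite /kl (f2 p1 q1)//; last by move=> t tpq; rewrite -path1 ?H//; lra.
    by rewrite (proj2 (bf2 p1 _)) ?(proj2 (bf2 q1 _))//; lra.
  rewrite /kl (f4 p1 q1)//; last by move=> t tpq; rewrite -path2 ?H//; lra.
  by rewrite (proj2 (af1 p1 _)) ?(proj2 (af1 q1 _))//; lra.
exists kr, kl; split=> //.
- by move=> t; exact: (cvgD (c1 t) (c3 t)).
- by move=> t; exact: (cvgD (c2 t) (c4 t)).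
- by move=> t u tu; apply: lerD; [exact: h1|exact: h3].
- by move=> t u tu; apply: lerD; [exact: h2|exact: h4].
- move=> t to; have [e1 e2] := bf1 t to.
  have [e3 e4] := bf2 t ltac:(lra); have [e5 e6] := bf2 o ltac:(lra).
  by rewrite /kr /kl e1 e2 e3 e4 e5 e6.
- move=> t qt; have [e1 e2] := af2 t qt.
  have [e3 e4] := af1 t ltac:(lra); have [e5 e6] := af1 q ltac:(lra).
  by rewrite /kr /kl e1 e2 e3 e4 e5 e6.
- move=> t toq; have [tp|pt] := leP t p.
    by rewrite path1//; apply: itv1; lra.
  by rewrite (path2 _ (ltW pt)); apply: itv2; lra.
Qed.

(* When the upper barrier stays out of reach, pushing up by the running supremum
   of the excess of [L] over the free path solves the two-sided problem. *)
Lemma one_sided_reflection L U s p q b : p <= q ->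
  continuous L -> continuous s -> L q <= b ->
  (forall t, p <= t <= q -> b + s q - s t < U t) ->
  (forall t u, p <= t <= q -> p <= u <= q -> L u + s u - s t < U t) ->
  exists kr kl, reflects L U s p q b kr kl.
Proof.
move=> pq Lc sc Lb far1 far2.
pose f u := L u - (b + s q) + s u.
have fc : continuous f.
  by move=> u; apply: cvgD; [apply: cvgB; [exact: Lc|exact: cvg_cst]|exact: sc].
have fq : f q <= 0 by rewrite /f; lra.
have [m [mc mhomo m_after m_before [fm mub flat]]] := running_supremum f p q pq fc fq.
have pathE t : reflected_path s q b (\- m) (cst 0) t = b + s q - s t + m t.
  by rewrite /reflected_path/= (m_after q (lexx _)); lra.
have below t : p <= t <= q -> b + s q - s t + m t < U t.
  move=> tpq; have [c] := EVT_max pq (continuous_subspaceT fc).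
  rewrite in_itv/= => cpq cmax.
  (* The maximum of 0 and [f c] splits into two cases: [far1] keeps the path below [U] in the first,
     [far2] in the second. *)
  have mt : m t <= Num.max 0 (f c).
    apply: mub; first by rewrite le_max lexx.
    by move=> u upq; rewrite le_max cmax ?orbT.
  have := far1 t tpq; have := far2 t c tpq cpq.
  by move: mt; rewrite le_max /f => /orP[]; lra.
(* [m] is nonincreasing in time, so its opposite is the nondecreasing regulator. *)
exists (\- m), (cst 0); split => //.
- by move=> t; apply: continuousN; exact: mc.
- exact: cst_continuous.
- by move=> t u tu /=; rewrite lerN2; exact: mhomo.
- by move=> t tp; split => //=; rewrite m_before.
- by move=> t tp; split => //=; rewrite !m_after.
- by move=> t tpq; have := below t tpq; have := fm t tpq; rewrite pathE /f; lra.
- move=> p' q' pp pq' qq H; congr (- _); apply: flat => // t tpq.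
  by have := H t tpq; rewrite pathE /f; lra.
Qed.

(** Near [t0] each of [L], [U], [s] moves by less than [e], an eighth of the gap. From a terminal
    value at most [L t0 + 4 * e] the path cannot reach [U]; from a larger one it cannot reach [L],
    and the mirror image applies. *)
Lemma locally_solvable L U s t0 : continuous L -> continuous U -> continuous s ->
  L t0 < U t0 -> exists2 d, 0 < d & forall p q, p <= q ->
    `|p - t0| < d -> `|q - t0| < d -> solvable L U s p q.
Proof.
move=> Lc Uc sc LU; pose e := (U t0 - L t0) / 8.
have e0 : 0 < e by rewrite /e; lra.
have /continuousPdist/(_ t0 e e0)[d1 d10 d1P] := Lc.
have /continuousPdist/(_ t0 e e0)[d2 d20 d2P] := Uc.
have /continuousPdist/(_ t0 e e0)[d3 d30 d3P] := sc.
exists (Num.min d1 (Num.min d2 d3)); first by rewrite !lt_min d10 d20 d30.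
move=> p q pq; rewrite !lt_min => /and3P[p1 p2 p3] /and3P[q1 q2 q3].
have near_ d v : `|p - t0| < d -> `|q - t0| < d -> p <= v <= q -> `|v - t0| < d.
  by rewrite !ltr_norml; lra.
have nL v : p <= v <= q -> - e < L v - L t0 < e.
  by move=> vpq; rewrite -ltr_norml; apply: d1P; exact: near_.
have nU v : p <= v <= q -> - e < U v - U t0 < e.
  by move=> vpq; rewrite -ltr_norml; apply: d2P; exact: near_.
have ns v : p <= v <= q -> - e < s v - s t0 < e.
  by move=> vpq; rewrite -ltr_norml; apply: d3P; exact: near_.
have qpq : p <= q <= q by rewrite pq lexx.
have nsq := ns q qpq.
have eE : U t0 = L t0 + 8 * e by rewrite /e; lra.
move=> b bq; have [bm|mb] := leP b (L t0 + 4 * e).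
  apply: one_sided_reflection => //; first by lra.
    by move=> t tpq; have := nU t tpq; have := ns t tpq; lra.
  move=> t u tpq upq; have := nU t tpq; have := ns t tpq; have := nL u upq.
  by have := ns u upq; lra.
have [|||||kl [kr H]] := one_sided_reflection (\- U) (\- L) (\- s) p q (- b) pq.
- by move=> t; apply: continuousN; exact: Uc.
- by move=> t; apply: continuousN; exact: sc.
- by rewrite /=; lra.
- by move=> t tpq /=; have := nL t tpq; have := ns t tpq; lra.
- move=> t u tpq upq /=; have := nL t tpq; have := ns t tpq; have := nU u upq.
  by have := ns u upq; lra.
by exists kr, kl; exact: reflectsN.
Qed.

(** Continuous induction: a reachable point close to the supremum of the reachable ones connects to
    points beyond that supremum, so [q] itself is reachable. *)
Lemma interval_induction (P : R -> R -> Prop) :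
  (forall o p q, o <= p <= q -> P o p -> P p q -> P o q) ->
  (forall t, exists2 d, 0 < d & forall p q, p <= q ->
    `|p - t| < d -> `|q - t| < d -> P p q) ->
  forall p q, p <= q -> P p q.
Proof.
move=> Ptrans Ploc p q pq; pose S := [set c | p <= c <= q /\ P p c].
have Sp : S p.
  split; first by rewrite lexx.
  by have [d d0] := Ploc p; apply => //; rewrite ?subrr ?normr0.
have uS : has_ubound S by exists q => c [/andP[_ cq] _].
have hS : has_sup S by split; [exists p|].
have pS : p <= sup S by apply: ub_le_sup.
have Sq : sup S <= q by apply: ge_sup; [exists p|move=> c [/andP[_ cq] _]].
have [d d0 dP] := Ploc (sup S).
have [c [cpq Pc] cS] := sup_adherent d0 hS.
have cS' : c <= sup S by apply: ub_le_sup.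
have Pstep c' : sup S <= c' -> c' < sup S + d -> P p c'.
  move=> Sc' c'd; apply: (Ptrans _ c); [lra|by []|].
  by apply: dP; rewrite ?ltr_norml; lra.
have [Sdq|qSd] := leP (sup S + d / 2) q; last by apply: Pstep; lra.
have : S (sup S + d / 2) by split; [lra|apply: Pstep; lra].
by move/(ub_le_sup uS); lra.
Qed.

Lemma reflection_solvable L U s p q : continuous L -> continuous U -> continuous s ->
  (forall t, L t < U t) -> p <= q -> solvable L U s p q.
Proof.
move=> Lc Uc sc LU; move: p q; apply: interval_induction => [p1 p2 p3|t].
  exact: solvable_trans.
exact: locally_solvable.
Qed.

End reflection.

(** * From reflection to the backward Skorokhod problem *)

Section existence.
Context {R : realType}.

Lemma I0T_shift (T : R) (k : R -> R) :
  continuous k -> {homo k : t u / t <= u} -> I0T T (fun t => k t - k 0).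
Proof.
move=> kc km; split; last by split=> [|t u _ tu _]; rewrite ?subrr// lerD2r km.
by apply: continuous_C0T => t; apply: cvgB; [exact: kc|exact: cvg_cst].
Qed.

(** A strict inequality between continuous functions defines a relatively open set, so constancy on
    its intervals gives a null Stieltjes integral. *)
Lemma regulator_stieltjes_null (T : R) (k y z : R -> R) (A : set R) :
  0 <= T -> continuous k -> {homo k : t u / t <= u} ->
  continuous y -> continuous z ->
  (forall t, 0 <= t <= T -> A t <-> y t < z t) ->
  (forall p q, 0 <= p -> p <= q -> q <= T ->
    (forall t, p <= t <= q -> y t < z t) -> k p = k q) ->
  stieltjes_null T (fun t => k t - k 0) A.
Proof.
move=> T0 kc km yc zc AE flat.
apply: flat_stieltjes_null => //; first exact: I0T_shift.
- move=> t tT /(AE t tT) yz; have e0 : 0 < z t - y t by lra.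
  have zyc : continuous (z \- y).
    by move=> u; apply: continuousB; [exact: zc|exact: yc].
  have /continuousPdist/(_ t _ e0)[d d0 dP] := zyc.
  exists d => // u uT /dP; rewrite AE// /= ltr_norml; lra.
- move=> p q p0 pq qT pqA; congr (_ - _); apply: flat => // t tpq.
  by apply/AE; [lra|exact: pqA].
Qed.

(** [L] and [U] stand for the zeros of [r] and [l]. Constant extension beyond [0, T] makes the data
    continuous and the barriers ordered on the whole line, as the reflection requires. *)
Lemma BSP_solution_exists (T : R) (l r : R -> R -> R) (L U s : R -> R) (a : R) :
  0 < T -> continuous L -> continuous U -> C0T T s ->
  (forall t, 0 <= t <= T -> L t < U t) ->
  (forall t, 0 <= t <= T -> forall y, (l t y < 0) = (y < U t)) ->
  (forall t, 0 <= t <= T -> forall y, (0 < r t y) = (L t < y)) ->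
  (forall t, 0 <= t <= T -> forall y, (l t y <= 0) = (y <= U t)) ->
  (forall t, 0 <= t <= T -> forall y, (0 <= r t y) = (L t <= y)) ->
  l T a <= 0 -> 0 <= r T a ->
  exists x k, BSP_solution T l r s a x k.
Proof.
move=> T0 Lc Uc sc LU lE rE leE reE la ra.
have T0' := ltW T0; have TT : 0 <= T <= T by rewrite T0' lexx.
have Lc' := continuous_extT _ _ T0' (continuous_C0T T _ Lc).
have Uc' := continuous_extT _ _ T0' (continuous_C0T T _ Uc).
have sc' := continuous_extT _ _ T0' sc.
have LU' t : extT T L t < extT T U t by apply: LU; exact: clamp_itv.
have aT : extT T L T <= a <= extT T U T.
  by rewrite !extT_id// -leE// -reE// la ra.
have [kr [kl [krc klc krm klm _ _ itv flatr flatl]]] :=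
  reflection_solvable _ _ _ _ _ Lc' Uc' sc' LU' T0' a aT.
pose x := reflected_path (extT T s) T a kr kl.
have xc : continuous x.
  move=> t; rewrite /x /reflected_path.
  apply: cvgB; last by apply: cvgB; [exact: cvg_cst|exact: klc].
  apply: cvgD; last by apply: cvgB; [exact: cvg_cst|exact: krc].
  by apply: cvgB; [exact: cvg_cst|exact: sc'].
(* Subtracting the value at 0 normalises the regulators and leaves their increments, hence the path,
   unchanged. *)
pose kr0 t := kr t - kr 0; pose kl0 t := kl t - kl 0.
have [krC [kr00 krM]] := I0T_shift T _ krc krm.
have [klC [kl00 klM]] := I0T_shift T _ klc klm.
exists x, (kr0 \- kl0); split; first exact: continuous_C0T.
split; first split.
- apply: continuous_C0T => t.
  by apply: cvgB; apply: cvgB; try exact: cvg_cst; [exact: krc|exact: klc].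
- split; first by rewrite /kr0 /kl0 /= !subrr.
  apply: bounded_variationD => //; last apply: bounded_variationN.
    apply: nondecreasing_bounded_variation => t u _ _ tu.
    by rewrite lerD2r krm.
  apply: nondecreasing_bounded_variation => t u _ _ tu.
  by rewrite lerD2r klm.
split.
  by move=> t tT; rewrite /x /reflected_path !extT_id// /kr0 /kl0 /=; lra.
split.
  move=> t tT; rewrite leE// reE//.
  by have /andP[] := itv t tT; rewrite !extT_id.
exists kr0, kl0; split; first exact: I0T_shift.
split; first exact: I0T_shift.
split=> //; split.
  apply: (regulator_stieltjes_null T kl x (extT T U)) => // t tT /=.
  by rewrite lE// extT_id.
apply: (regulator_stieltjes_null T kr (extT T L) x) => // t tT /=.
by rewrite rE// extT_id.
Qed.

End existence.

(** * Existence and uniqueness under Assumption (A) *)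

Theorem mainTheorem1 (R : realType) (T : R) (l r : R -> R -> R) :
  0 < T -> assumptionA T l r ->
  forall (s : R -> R) (a : R), C0T T s -> l T a <= 0 -> 0 <= r T a ->
  exists x k : R -> R, BSP_solution T l r s a x k /\
    forall x' k' : R -> R, BSP_solution T l r s a x' k' ->
      forall t, 0 <= t <= T -> x' t = x t /\ k' t = k t.
Proof.
move=> T0 [lrc [lrinc [[c [C [c0 [_ lip]]]] [delta [delta0 gap]]]]] s a sc la ra.
have T0' := ltW T0.
have linc t : 0 <= t <= T -> {homo l t : y z / y < z}.
  by move=> tT y z /(lrinc t tT)[].
have rinc t : 0 <= t <= T -> {homo r t : y z / y < z}.
  by move=> tT y z /(lrinc t tT)[].
have [U [Uc U0]] : exists z, continuous z /\ forall t, 0 <= t <= T -> l t (z t) = 0.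
  apply: (zero_curve T c C) => // [x|t tT x y]; first by have [] := lrc x.
  by have [? []] := lip t tT x y.
have [L [Lc L0]] : exists z, continuous z /\ forall t, 0 <= t <= T -> r t (z t) = 0.
  apply: (zero_curve T c C) => // [x|t tT x y]; first by have [] := lrc x.
  by have [? [? []]] := lip t tT x y.
have lle t : 0 <= t <= T -> {mono l t : y z / y <= z}.
  by move=> tT; apply: le_mono; exact: linc.
have rle t : 0 <= t <= T -> {mono r t : y z / y <= z}.
  by move=> tT; apply: le_mono; exact: rinc.
have [x [k xk]] : exists x k, BSP_solution T l r s a x k.
  apply: (BSP_solution_exists T l r L U) => //.
  (* At [L t], where [r] vanishes, the gap makes [l] at most [- delta], so [L t] lies below the zero
     [U t] of [l]. *)
  - move=> t tT; rewrite -(leW_mono (lle t tT)) U0//.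
    by have := gap t tT (L t); rewrite L0//; lra.
  - by move=> t tT y; rewrite -(U0 t tT) (leW_mono (lle t tT)).
  - by move=> t tT y; rewrite -(L0 t tT) (leW_mono (rle t tT)).
  - by move=> t tT y; rewrite -(U0 t tT) lle.
  - by move=> t tT y; rewrite -(L0 t tT) rle.
exists x, k; split=> // x' k' xk'.
have xx' t : 0 <= t <= T -> x' t = x t.
  move=> tT; apply/eqP; rewrite eq_le.
  by rewrite (BSP_solution_le _ _ _ _ _ _ _ _ _ T0' linc rinc xk' xk t tT)
    (BSP_solution_le _ _ _ _ _ _ _ _ _ T0' linc rinc xk xk' t tT).
have [_ [[_ [k0 _]] [xE _]]] := xk; have [_ [[_ [k0' _]] [xE' _]]] := xk'.
move=> t tT; split; first exact: xx'.
have z0 : 0 <= (0 : R) <= T by lra.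
(* The equation at times 0 and [t] with [k 0 = 0] forces [k t = x 0 - x t + s 0 - s t], so equal
   paths have equal regulators. *)
have := xx' t tT; have := xx' 0 z0; rewrite !xE// !xE'// k0 k0'; lra.
Qed.
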